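(* Let $p$ be an odd prime, $n\ge 1$, and let $f(x)=\sum_{i=1}^k a_i x^{p^{\alpha_i}+1}\in\mathbb F_{p^n}[x]$ with $k\ge 1$, integers $0\le\alpha_1<\cdots<\alpha_k$, and $a_k\ne 0$. Let $q$ be an odd prime with $q\ne p$ and let $s\ge 0$ be an integer. Then $$t_{q^sn}(f)=t_n(f)\left(\frac qp\right)^{s\,l_n(f)}(-1)^{\frac 14(p-1)[l_{q^sn}(f)-l_n(f)]+\frac 1{o_q(p)}[l_{q^sn}(f)-l_n(f)]}.$$
   Context: Every quadratic form $F$ on an $N$-dimensional $\mathbb F_p$-vector space ($p$ odd) is, after a linear change of coordinates, equal to $x_1^2+\cdots+x_{r-1}^2+d x_r^2$ with $r\ge 0$ and $d\in\mathbb F_p^*$. The integer $r$ is the rank of $F$, $N-r$ is its nullity, and $\eta(d)\in\{\pm1\}$ is its type, where $\eta$ is the quadratic character of $\mathbb F_p$; if $F=0$ its type is defined to be $1$. For a positive integer $N$ divisible by $n$, $\mathrm{Tr}_N$ is the absolute trace $\mathbb F_{p^N}\to\mathbb F_p$; the map $x\mapsto \mathrm{Tr}_N(f(x))$ is a quadratic form on the $N$-dimensional $\mathbb F_p$-space $\mathbb F_{p^N}$, and $l_N(f)$, $t_N(f)$ denote its nullity and type. $\left(\frac qp\right)$ is the Legendre symbol and $o_q(p)$ is the multiplicative order of $p$ modulo $q$. (The difference $l_{q^sn}(f)-l_n(f)$ is divisible by $2$ and by $o_q(p)$, so the exponent of $-1$ is an integer.) *)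

(* Defs.v *)
From HB Require Import structures.
From mathcomp Require Import all_boot all_order all_algebra all_fingroup all_field.

Set Implicit Arguments.
Unset Strict Implicit.
Unset Printing Implicit Defensive.

Import GRing.Theory.
Local Open Scope ring_scope.

(* For F = 'F_p and d = q%:R, p an odd prime, this is the Legendre symbol
   (q/p). *)
Definition quad_char (F : finFieldType) (d : F) : int :=
  if d == 0 then 0 else if [exists y : F, y ^+ 2 == d] then 1 else -1.

Section QuadraticForms.
Variables (F : finFieldType) (N : nat).
Implicit Types (Q : 'rV[F]_N -> F) (r : nat) (d : F).

(* x_1^2 + ... + x_(r-1)^2 + d x_r^2, with the coordinates indexed from 0. *)
Definition diag_form r d (x : 'rV[F]_N) : F :=
  \sum_(i < N | (i < r)%N) (if i.+1 == r then d else 1) * x 0 i ^+ 2.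

Definition is_normal_form Q r d : bool :=
  [&& (r <= N)%N, d != 0
    & [exists M : 'M[F]_N, (M \in unitmx) &&
        [forall x : 'rV[F]_N, Q (x *m M) == diag_form r d x]]].

(* When F has odd characteristic, every quadratic form has a normal form, so
   the default (0, 1) is not used; neither the rank nor the type below depends
   on which normal form is picked, although d itself does. *)
Definition normal_form Q : 'I_N.+1 * F :=
  odflt (ord0, 1) [pick rd : 'I_N.+1 * F | is_normal_form Q rd.1 rd.2].

Definition quad_rank Q : nat := (normal_form Q).1.

Definition quad_nullity Q : nat := N - quad_rank Q.

Definition quad_type Q : int :=
  if [forall x, Q x == 0] then 1 else quad_char (normal_form Q).2.

End QuadraticForms.

Section TraceForms.
Variables (p : nat) (L : fieldExtType 'F_p).

(* The element of 'F_p whose image in L is x + x^p + ... + x^(p^(N-1)),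
   N = [L : F_p]; see abs_traceE. *)
Definition abs_trace (x : L) : 'F_p :=
  odflt 0 [pick c : 'F_p | c%:A == \sum_(i < \dim {:L}) x ^+ (p ^ i)].

Lemma abs_traceE (x : L) : prime p ->
  (abs_trace x)%:A = \sum_(i < \dim {:L}) x ^+ (p ^ i).
Proof.
move=> p_pr; rewrite /abs_trace; set T := \sum_(i < _) _.
have charL : p \in [pchar L] by rewrite pchar_lalg pchar_Fp.
have TpE : T ^+ p = T.
  rewrite -(pFrobenius_autE charL) rmorph_sum /=.
  under eq_bigr => i _ do rewrite pFrobenius_autE -exprM -expnSr.
  rewrite /T; case E: (\dim {:L}) => [|m]; first by rewrite !big_ord0.
  rewrite big_ord_recr [RHS]big_ord_recl /= addrC; congr (_ + _).
  rewrite expn0 expr1 -E.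
  have := Fermat's_little_theorem {:L}%AS x.
  by rewrite memvf card_Fp // => /esym/eqP.
have : T \in 1%VS.
  by rewrite (Fermat's_little_theorem 1%AS) dimv1 expn1 card_Fp // TpE.
case/vlineP=> c cE; case: pickP => [d /eqP // | /(_ c)].
by rewrite cE eqxx.
Qed.

(* The form x |-> Tr_N(g(x)) on L, in the coordinates given by a basis of L
   over 'F_p; the rank and the type do not depend on the basis. *)
Definition trace_form (g : {poly L}) (u : 'rV['F_p]_(\dim {:L})) : 'F_p :=
  abs_trace g.[\sum_i u 0 i *: (vbasis {:L})`_i].

Definition trace_nullity (g : {poly L}) : nat := quad_nullity (trace_form g).

Definition trace_type (g : {poly L}) : int := quad_type (trace_form g).

End TraceForms.

(* The multiplicative order of a modulo a prime q not dividing a. *)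
Definition ord_mod (q a : nat) : nat :=
  #[insubd (1%g : {unit 'F_q}) (a%:R : 'F_q)]%g.

(* Main.v *)
Require Import Defs.
From HB Require Import structures.
From mathcomp Require Import all_boot all_order all_algebra all_fingroup.
From mathcomp Require Import all_solvable all_field ring zify.

Set Implicit Arguments.
Unset Strict Implicit.
Unset Printing Implicit Defensive.

Import GRing.Theory.
Local Open Scope ring_scope.

(* Let psi be a nontrivial additive character of F_p with values in a finite
   field E of characteristic q, and g its quadratic Gauss sum.  A quadratic form
   Q on an N-dimensional space, of nullity l and type t, satisfies
     sum_x psi(c Q(x)) = p^l t (eta(c) g)^(N - l)   for c <> 0.
   The map x |-> x^(p^n) generates a q-group of symmetries of Tr(f) on
   F_(p^(q^s n)), whose fixed points form F_(p^n), where Tr(f) restricts to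
   q^s times the form of level n.  As E has characteristic q, only the fixed
   points contribute to the character sum, so the sums at the two levels agree
   in E, up to replacing c by q^s c.  Taking c a nonsquare shows that
   D = l_(q^s n)(f) - l_n(f) is even; taking c = 1 and using
   g^2 = eta(-1) p and the Frobenius relation g^q = eta(q) g, one finds
     t_(q^s n)(f) = t_n(f) eta(q)^(s l_n(f)) eta(-1)^(D/2) p^(-D/2)   in E.
   Hence p^(D/2) = +-1 in E, so that o_q(p) divides D and
   p^(D/2) = (-1)^(D / o_q(p)). *)

(** * The quadratic character of a finite field *)

(** The nonzero elements are [#|F|.-1] distinct roots of unity of order dividing [#|F|.-1], enough
    to force a primitive one. *)
Lemma finField_primitive_root (F : finFieldType) :
  exists w : F, #|F|.-1.-primitive_root w.
Proof.
have F_gt1 := finNzRing_gt1 F; have F_gt0 := ltnW F_gt1.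
have F1_gt0 : (0 < #|F|.-1)%N by rewrite -ltnS prednK.
pose rs := [seq x <- enum F | x != 0].
have uniq_rs : uniq rs by rewrite filter_uniq ?enum_uniq.
have size_rs : (#|F|.-1 <= size rs)%N.
  rewrite size_filter -(leq_add2r 1) addn1 prednK // cardE.
  rewrite -(count_predC (fun x => x != 0) (enum F)) leq_add2l.
  rewrite (eq_count (a2 := pred1 0)); last by move=> x /=; rewrite negbK.
  by rewrite count_uniq_mem ?enum_uniq // leq_b1.
have rs1 : all #|F|.-1.-unity_root rs.
  apply/allP=> x; rewrite mem_filter unity_rootE => /andP[x0 _].
  by apply/eqP/(mulfI x0); rewrite -exprS prednK ?expf_card ?mulr1.
by have /hasP[w _ w_prim] := has_prim_root F1_gt0 rs1 uniq_rs size_rs; exists w.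
Qed.

Lemma sqrr_eq1 (R : idomainType) (x : R) : x ^+ 2 = 1 -> x = 1 \/ x = -1.
Proof. by move=> /eqP; rewrite sqrf_eq1 => /orP[] /eqP; [left | right]. Qed.

Section QuadraticCharacter.
Variables (F : finFieldType) (two_neq0 : 2%:R != 0 :> F).
Implicit Types c d x y : F.

Lemma oddchar_one_neqN1 : 1 != -1 :> F.
Proof. by rewrite -subr_eq0 opprK -[1 + 1]/(2%:R). Qed.

(** If [#|F|.-1] were odd, [(-1) ^+ #|F|] would be 1, while [expf_card] makes it -1. *)
Lemma even_card_predn : ~~ odd #|F|.-1.
Proof.
have F_gt0 := ltnW (finNzRing_gt1 F).
apply/negP=> oddF; have /eqP := expf_card (-1 : F).
rewrite -{1}(prednK F_gt0) exprS -signr_odd oddF expr1 mulrNN mulr1.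
by rewrite (negPf oddchar_one_neqN1).
Qed.

(** Euler's criterion. For a primitive root [w], [w ^+ m] is a square root of 1 other than 1, and a
    nonsquare is an odd power of [w]. *)
Lemma euler_quad_char d : (quad_char d)%:~R = d ^+ (#|F|.-1)./2.
Proof.
have [w w_prim] := finField_primitive_root F.
have F_gt1 := finNzRing_gt1 F; have F_gt0 := ltnW F_gt1.
have m2 : ((#|F|.-1)./2.*2 = #|F|.-1)%N by rewrite even_halfK // even_card_predn.
have m_gt0 : (0 < (#|F|.-1)./2)%N.
  by rewrite -double_gt0 m2 -ltnS prednK.
set m := (#|F|.-1)./2 in m2 m_gt0 *.
rewrite /quad_char; have [-> | d0] := eqVneq d 0.
  by rewrite expr0n eqn0Ngt m_gt0.
have fermat x : x != 0 -> x ^+ #|F|.-1 = 1.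
  by move=> x0; apply/(mulfI x0); rewrite -exprS prednK ?expf_card ?mulr1.
case: existsP => [[y /eqP yd] | no_root] /=.
  rewrite -yd -exprM mul2n m2 fermat //; apply: contraNneq d0 => y0.
  by rewrite -yd y0 expr0n.
have [i di] := prim_rootP w_prim (fermat d d0).
have odd_i : odd i.
  apply/negPn/negP=> even_i; case: no_root; exists (w ^+ i./2).
  by rewrite -exprM muln2 even_halfK // di.
have wm : w ^+ m = -1.
  case: (@sqrr_eq1 _ (w ^+ m)) => //.
    by rewrite -exprM muln2 m2 (prim_expr_order w_prim).
  move/eqP; rewrite -(prim_order_dvd w_prim) -m2 -muln2 => /dvdn_leq => /(_ m_gt0).
  by rewrite -[X in (_ <= X)%N]muln1 leq_pmul2l.
by rewrite di -exprM mulnC exprM wm -signr_odd odd_i.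
Qed.

Lemma quad_char_cases d : d != 0 -> quad_char d = 1 \/ quad_char d = -1.
Proof.
by rewrite /quad_char => /negPf->; case: ifP; [left | right].
Qed.

(** Euler's criterion gives the identity in [F], where 0, 1 and -1 stay distinct, so it lifts to the
    integers. *)
Lemma quad_charM c d : quad_char (c * d) = quad_char c * quad_char d.
Proof.
have inj (i j : int) : i \in [:: 0; 1; -1] -> j \in [:: 0; 1; -1] ->
    i%:~R = j%:~R :> F -> i = j.
  have n01 := oner_neq0 F; have n1N := oddchar_one_neqN1.
  have nN0 : -1 != 0 :> F by rewrite oppr_eq0.
  rewrite !inE => /or3P[] /eqP-> /or3P[] /eqP-> //=;
    rewrite ?rmorphN ?rmorph1 ?rmorph0 => /eqP;
    by rewrite ?(negPf n01) ?(negPf n1N) ?(negPf nN0) 1?eq_sym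
        ?(negPf n01) ?(negPf n1N) ?(negPf nN0).
have mem (e : F) : quad_char e \in [:: 0; 1; -1].
  by rewrite /quad_char; case: ifP => // _; case: ifP.
apply: inj; rewrite ?rmorphM /= ?euler_quad_char ?exprMn //.
by have := mem c; have := mem d; rewrite !inE;
  move=> /or3P[] /eqP-> /or3P[] /eqP->.
Qed.

Lemma quad_char1 : quad_char (1 : F) = 1.
Proof.
rewrite /quad_char oner_eq0; case: existsP => // -[]; exists 1.
by rewrite expr1n.
Qed.

Lemma quad_charX c i : quad_char (c ^+ i) = quad_char c ^+ i.
Proof. by elim: i => [|i IHi]; rewrite ?quad_char1 // !exprS quad_charM IHi. Qed.

(** Were squaring onto the finite set [F], it would be injective, yet 1 and -1 have the same
    square. *)
Lemma exists_nonsquare : exists2 c : F, c != 0 & quad_char c = -1.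
Proof.
have [/forallP sq_surj | /forallPn[c c_nsq]] :=
    boolP [forall c : F, exists y : F, y ^+ 2 == c].
  pose sqrt c := xchoose (existsP (sq_surj c)).
  have sqrtK : cancel sqrt (fun y => y ^+ 2).
    by move=> c; apply/eqP; exact: xchooseP (existsP (sq_surj c)).
  have := can_inj (canF_sym sqrtK).
  move=> /(_ 1 (-1)); rewrite sqrrN => /(_ erefl) /eqP.
  by rewrite (negPf oddchar_one_neqN1).
have c0 : c != 0.
  apply: contraNneq c_nsq => ->; apply/existsP; exists 0.
  by rewrite expr0n.
by exists c => //; rewrite /quad_char (negPf c0) (negPf c_nsq).
Qed.

Lemma quad_char_eq1 c : quad_char c = 1 -> exists y : F, y ^+ 2 = c.
Proof.
by rewrite /quad_char; case: eqP => // _; case: existsP => // -[y /eqP]; exists y.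
Qed.

Lemma quad_char_sqr y : y != 0 -> quad_char (y ^+ 2) = 1.
Proof.
by move=> y0; rewrite quad_charX; case: (quad_char_cases y0) => ->.
Qed.

(* If sums of two squares were squares, -1 would be a square, being a sum of
   ones, and then so would x = ((x + 1) / 2)^2 - ((x - 1) / 2)^2 for every x. *)
Lemma nonsquare_sum_sqr : exists x y : F, quad_char (x ^+ 2 + y ^+ 2) = -1.
Proof.
have [/existsP[x /existsP[y /eqP xy]] | no] :=
    boolP [exists x : F, exists y : F, quad_char (x ^+ 2 + y ^+ 2) == -1].
  by exists x, y.
have sum_sq x y : exists z, x ^+ 2 + y ^+ 2 = z ^+ 2.
  have [-> | xy0] := eqVneq (x ^+ 2 + y ^+ 2) 0.
    by exists 0; rewrite expr0n.
  have [/quad_char_eq1[z <-]|xyN] := quad_char_cases xy0; first by exists z.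
  by case/existsP: no; exists x; apply/existsP; exists y; rewrite xyN.
have nat_sq n : exists z : F, n%:R = z ^+ 2.
  elim: n => [|n [z nz]]; first by exists 0; rewrite expr0n.
  have [t zt] := sum_sq z 1; exists t.
  by rewrite -zt expr1n -nz -addn1 natrD.
have [i Ni] : exists i : F, -1 = i ^+ 2.
  have [r r_pr rF] := finPcharP F; have [i ri] := nat_sq r.-1.
  exists i; rewrite -ri; apply/eqP; rewrite eq_sym -subr_eq0 opprK natr1.
  by rewrite prednK ?prime_gt0 // (pcharf0 rF).
have [c c0 cN] := exists_nonsquare.
have [z zc] := sum_sq ((c + 1) / 2%:R) (i * ((c - 1) / 2%:R)).
suff cz : c = z ^+ 2.
  have z0 : z != 0 by apply: contraNneq c0 => z0; rewrite cz z0 expr0n.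
  by move: cN; rewrite cz quad_char_sqr.
by rewrite -zc [(i * _) ^+ 2]exprMn -Ni; field.
Qed.

(** A square coefficient settles the matter alone. If both are nonsquares, c (u^2 + v^2) is a square
    for a nonsquare u^2 + v^2, and c v^2 turns into d times a square because c d = e^2. *)
Lemma binary_form_represents1 c d : c != 0 -> d != 0 ->
  exists x y : F, c * x ^+ 2 + d * y ^+ 2 = 1.
Proof.
move=> c0 d0.
have sq e : e != 0 -> quad_char e = 1 -> exists x, e * x ^+ 2 = 1.
  move=> e0 /quad_char_eq1[z ez]; exists z^-1.
  by rewrite -ez exprVn mulfV // ez.
case: (quad_char_cases c0) => [/(sq c c0)[x cx]|cN].
  by exists x, 0; rewrite expr0n mulr0 addr0.
case: (quad_char_cases d0) => [/(sq d d0)[y dy]|dN].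
  by exists 0, y; rewrite expr0n mulr0 add0r.
have [u [v uv]] := nonsquare_sum_sqr.
have cuv0 : c * (u ^+ 2 + v ^+ 2) != 0.
  rewrite mulf_eq0 negb_or c0; apply/negP => /eqP uv0.
  by move: uv; rewrite uv0 /quad_char eqxx.
have [|t ct] := sq _ cuv0; first by rewrite quad_charM cN uv.
have [|e cde] := @quad_char_eq1 (c * d); first by rewrite quad_charM cN dN.
have e0 : e != 0.
  by apply: contraNneq (mulf_neq0 c0 d0) => e0; rewrite -cde e0 expr0n.
exists (u * t), (v * t * c / e).
by rewrite !exprMn exprVn cde -ct; field; rewrite c0 d0.
Qed.

End QuadraticCharacter.

(** * Normal forms of quadratic forms *)

Definition mx_form (F : nzRingType) n (A : 'M[F]_n) (u : 'rV[F]_n) : F :=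
  (u *m A *m u^T) 0 0.

Lemma mx_form_congr (F : comNzRingType) n (A g : 'M[F]_n) u :
  mx_form A (u *m g) = mx_form (g *m A *m g^T) u.
Proof. by rewrite /mx_form trmx_mul !mulmxA. Qed.

Lemma mx_form_block (F : comNzRingType) n (c : F) (A : 'M[F]_n) x u :
  mx_form (block_mx c%:M 0 0 A) (row_mx x%:M u : 'rV_(1 + n))
    = c * x ^+ 2 + mx_form A u.
Proof.
rewrite /mx_form mul_row_block !mulmx0 addr0 add0r tr_row_mx mul_row_col.
rewrite mxE; congr (_ + _); rewrite -scalar_mxM tr_scalar_mx -scalar_mxM mxE eqxx.
by rewrite mulr1n; ring.
Qed.

Section NormalForms.
Variables (F : finFieldType) (two_neq0 : 2%:R != 0 :> F).

Lemma mx_form_symmetrize n (A : 'M[F]_n) u :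
  mx_form A u = mx_form (2%:R^-1 *: (A + A^T)) u.
Proof.
rewrite /mx_form -scalemxAr -scalemxAl mulmxDr mulmxDl [RHS]mxE [X in _ * X]mxE.
have -> : (u *m A^T *m u^T) 0 0 = (u *m A *m u^T) 0 0.
  by rewrite -[in RHS](trmxK (u *m A *m u^T)) [in RHS]mxE !trmx_mul trmxK mulmxA.
by field.
Qed.

(** Polarization: if the form vanishes on the basis vectors, its value at [e i + e j] is twice
    [A i j]. *)
Lemma mx_form_eq0 n (A : 'M[F]_n) :
  A^T = A -> (forall u, mx_form A u = 0) -> A = 0.
Proof.
move=> symA A0; apply/matrixP=> i j; rewrite mxE.
pose e k : 'rV[F]_n := delta_mx 0 k.
have eAe k l : (e k *m A *m (e l)^T) 0 0 = A k l.
  by rewrite -rowE trmx_delta -colE !mxE.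
have := A0 (e i + e j); rewrite /mx_form linearD /= !mulmxDl !mulmxDr.
rewrite mxE [X in X + _]mxE [X in _ + X]mxE -!/(mx_form _ _) !A0 !eAe.
rewrite -{2}symA mxE add0r addr0 => Aij.
by apply/eqP; move/eqP: Aij; rewrite -mulr2n -mulr_natl mulf_eq0 (negPf two_neq0).
Qed.

Lemma extend_to_unitmx n (v : 'rV[F]_(1 + n)) :
  v != 0 -> exists2 P : 'M[F]_(1 + n), P \in unitmx & v = delta_mx 0 0 *m P.
Proof.
move=> v0; pose U : 'rV[F]_(1 + n) := delta_mx 0 0.
have Uv : U *m ((delta_mx 0 0 : 'cV_(1 + n)) *m v) = v.
  rewrite mulmxA mul_delta_mx; apply/rowP=> j.
  by rewrite mxE big_ord1 mxE mul1r.
(* The rank one matrix sends [U] to [v]; [complete_unitmx] replaces it by an invertible one with the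
   same effect on [U]. *)
have [|P P_unit PU] := @complete_unitmx _ _ _ U ((delta_mx 0 0 : 'cV_(1 + n)) *m v).
  by rewrite Uv mxrank_delta rank_rV v0.
by exists P => //; rewrite -PU Uv.
Qed.

(** Completing the square: [P] takes the first basis vector to [v], the shear [h] clears the rest of
    the first row and column, and [A'] is the Schur complement of the corner [c]. *)
Lemma mx_form_split n (A : 'M[F]_(1 + n)) (v : 'rV[F]_(1 + n)) :
    A^T = A -> mx_form A v != 0 ->
  exists2 g : 'M[F]_(1 + n), g \in unitmx & exists2 A' : 'M[F]_n, A'^T = A' &
    forall x u, mx_form A (row_mx x%:M u *m g)
                  = mx_form A v * x ^+ 2 + mx_form A' u.
Proof.
move=> symA; set c := mx_form A v => c0.
have v0 : v != 0.
  by apply: contraNneq c0 => v0; rewrite /c /mx_form v0 !mul0mx mxE.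
have [P P_unit vP] := extend_to_unitmx v0.
pose B : 'M_(1 + n) := P *m A *m P^T.
have symB : B^T = B by rewrite /B !trmx_mul trmxK symA mulmxA.
pose b := ursubmx B.
have dlB : dlsubmx B = b^T by rewrite trmx_ursub symB.
have ulB : ulsubmx B = c%:M.
  rewrite [ulsubmx B]mx11_scalar; congr _%:M.
  rewrite /c vP mx_form_congr -/B /mx_form -rowE trmx_delta -colE.
  by rewrite [RHS]mxE [RHS]mxE [LHS]mxE [LHS]mxE; congr (B _ _); apply/val_inj.
pose h : 'M[F]_(1 + n) := block_mx 1%:M 0 (- c^-1 *: b^T) 1%:M.
exists (h *m P).
  by rewrite unitmx_mul P_unit andbT unitmxE det_lblock !det1 mulr1 unitr1.
exists (drsubmx B - c^-1 *: (b^T *m b)).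
  rewrite linearB /= linearZ /= trmx_mul trmxK; congr (_ - _).
  by rewrite trmx_drsub symB.
move=> x u; rewrite mulmxA mx_form_congr -/B mx_form_congr.
rewrite -mx_form_block; congr mx_form.
rewrite -[B]submxK ulB dlB -/b /h tr_block_mx !trmx1 trmx0.
rewrite !mulmx_block !mul1mx !mulmx1 !mul0mx !mulmx0 !addr0.
rewrite linearZ /= trmxK.
have cK : - c^-1 *: b^T *m c%:M + b^T = 0.
  by rewrite mul_mx_scalar scalerA mulrN divff // scaleN1r addNr.
have cK' : c%:M *m (- c^-1 *: b) + b = 0.
  by rewrite mul_scalar_mx scalerA mulrN divff // scaleN1r addNr.
by rewrite cK cK' !mul0mx add0r block_mxKdr -scalemxAl scaleNr addrC.
Qed.

(** The special coefficient sits on the last coordinate of the form, so a coordinate put in front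
    carries it only when [r] is 0. *)
Lemma diag_form_row n r (c d x : F) (u : 'rV[F]_n) :
  diag_form r.+1 (if r is 0%N then c else d) (row_mx x%:M u : 'rV_(1 + n))
    = (if r is 0%N then c else 1) * x ^+ 2 + diag_form r d u.
Proof.
rewrite /diag_form big_mkcond big_split_ord /= big_ord1 row_mxEl mxE eqxx mulr1n /=.
congr (_ + _); first by case: r.
rewrite [RHS]big_mkcond; apply: eq_bigr => i _.
rewrite row_mxEr add1n ltnS eqSS; case: ltnP => // ir.
by case: r ir.
Qed.

(** Induction on the dimension. If the form takes the value 1, that square is split off. A nonzero
    form without the value 1 has rank 1: after splitting off any nonzero value, the rest vanishes,
    or else [binary_form_represents1] would produce 1. *)
Lemma sym_mx_form_normal n (A : 'M[F]_n) : A^T = A ->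
  exists r d, is_normal_form (mx_form A) r d.
Proof.
elim: n A => [|n IHn] A symA.
  exists 0%N, 1; rewrite /is_normal_form leqnn oner_neq0 /=.
  apply/existsP; exists 1%:M; rewrite unitmx1; apply/forallP=> u.
  by rewrite /mx_form [A]flatmx0 mulmx0 mul0mx mxE /diag_form big_ord0.
have of_mx r d (M : 'M[F]_(1 + n)) : (r <= n.+1)%N -> d != 0 -> M \in unitmx ->
    (forall x (u : 'rV_n), mx_form A (row_mx x%:M u *m M)
       = diag_form r d (row_mx x%:M u : 'rV_(1 + n))) ->
    exists r d, is_normal_form (mx_form A) r d.
  move=> rn d0 M_unit AM; exists r, d; rewrite /is_normal_form rn d0 /=.
  apply/existsP; exists M; rewrite M_unit; apply/forallP=> /= y.
  by rewrite -[y](@hsubmxK _ 1 1 n) [lsubmx _]mx11_scalar AM.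
have [/forallP A0 | /forallPn[v Av0]] := boolP [forall u, mx_form A u == 0].
  have {}A0 : A = 0 by apply: mx_form_eq0 => // u; apply/eqP.
  apply: (of_mx 0%N 1 1%:M); rewrite ?oner_neq0 ?unitmx1 // => x u.
  by rewrite A0 /mx_form mulmx0 mul0mx mxE /diag_form big_pred0.
have [/existsP[w /eqP Aw] | no1] := boolP [exists u, mx_form A u == 1].
  have [|g g_unit [A' symA' gA]] := mx_form_split (v := w) symA.
    by rewrite Aw oner_neq0.
  have [r [d /and3P[rn d0 /existsP[M /andP[M_unit /forallP AM]]]]] := IHn A' symA'.
  apply: (of_mx r.+1 (if r is 0%N then 1 else d) (block_mx 1%:M 0 0 M *m g)) => //.
  - by case: (r); rewrite ?oner_neq0.
  - by rewrite unitmx_mul g_unit unitmxE det_ublock det1 mul1r -unitmxE M_unit.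
  move=> x u; rewrite mulmxA mul_row_block !mulmx0 addr0 add0r mulmx1 gA Aw.
  by rewrite (eqP (AM u)) diag_form_row; case: (r).
have [g g_unit [A' symA' gA]] := mx_form_split symA Av0.
apply: (of_mx 1%N (mx_form A v) g) => // x u.
rewrite (diag_form_row 0 _ 1) gA; congr (_ + _).
have -> : diag_form 0 1 u = 0 by rewrite /diag_form big_pred0.
apply/eqP; apply: contraNT no1 => A'u0; apply/existsP.
have [y [z yz]] := binary_form_represents1 two_neq0 Av0 A'u0.
exists (row_mx y%:M (z *: u) *m g); rewrite gA -yz; apply/eqP; congr (_ + _).
rewrite /mx_form linearZ /= -!scalemxAl -scalemxAr !mxE.
by ring.
Qed.

Lemma mx_form_normal n (A : 'M[F]_n) (Q : 'rV[F]_n -> F) : Q =1 mx_form A ->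
  exists r d, is_normal_form Q r d.
Proof.
move=> QA; have [|r [d nf]] := @sym_mx_form_normal n (2%:R^-1 *: (A + A^T)).
  by rewrite linearZ /= linearD /= trmxK addrC.
exists r, d; case/and3P: nf => rn d0 /existsP[M /andP[M_unit /forallP AM]].
apply/and3P; split=> //; apply/existsP; exists M; rewrite M_unit /=.
by apply/forallP=> u; rewrite QA mx_form_symmetrize.
Qed.

End NormalForms.

(** * Gauss sums *)

Lemma card_sqrt (F : finFieldType) (two_neq0 : 2%:R != 0 :> F) (y : F) :
  #|[pred x : F | x ^+ 2 == y]|%:Z = 1 + quad_char y.
Proof.
have [-> | y0] := eqVneq y 0.
  rewrite /quad_char eqxx addr0 (eq_card (B := pred1 0)) ?card1 // => x.
  by rewrite !inE expf_eq0.
have [/[dup] /quad_char_eq1[z zy] ->|yN] := quad_char_cases y0.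
  have z0 : z != 0 by apply: contraNneq y0 => z0; rewrite -zy z0 expr0n.
  rewrite (eq_card (B := pred2 z (- z))) => [|x]; last first.
    by rewrite !inE -zy eqf_sqr.
  rewrite card2 -subr_eq0 opprK -mulr2n -mulr_natl mulf_eq0.
  by rewrite (negPf two_neq0) (negPf z0).
rewrite yN subrr eq_card0 // => x; rewrite !inE; apply/eqP=> xy.
have x0 : x != 0 by apply: contraNneq y0 => x0; rewrite -xy x0 expr0n.
by move: yN; rewrite -xy quad_char_sqr.
Qed.

Section GaussSums.
Variables (F : finFieldType) (two_neq0 : 2%:R != 0 :> F) (E : fieldType).
Variable psi : F -> E.
Hypothesis psi0 : psi 0 = 1.
Hypothesis psiD : forall x y, psi (x + y) = psi x * psi y.
Hypothesis psi_neq1 : exists z, psi z != 1.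

Local Notation eta c := ((quad_char c)%:~R : E).

Lemma psi_sum (I : finType) (h : I -> F) : psi (\sum_i h i) = \prod_i psi (h i).
Proof. exact: (big_morph psi psiD psi0). Qed.

Lemma psiMn x i : psi (x *+ i) = psi x ^+ i.
Proof. by elim: i => [|i IHi]; rewrite ?psi0 // mulrS exprS psiD IHi. Qed.

(** For nonzero [c], translating by [z / c] multiplies the sum by [psi z], which differs from 1. *)
Lemma sum_psi c : \sum_x psi (c * x) = if c == 0 then #|F|%:R else 0.
Proof.
have [-> | c0] := eqVneq c 0.
  under eq_bigr => x _ do rewrite mul0r psi0.
  by rewrite sumr_const.
have [z z1] := psi_neq1.
have: psi z * (\sum_x psi (c * x)) = \sum_x psi (c * x).
  rewrite mulr_sumr [RHS](reindex (+%R (z / c))) /=; last first.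
    by exists (+%R (- (z / c))) => x _; rewrite ?addKr ?addNKr.
  by apply: eq_bigr => x _; rewrite -psiD mulrDr [c * (z / c)]mulrC divfK.
move/eqP; rewrite -subr_eq0 -{2}[\sum_x _]mul1r -mulrBl mulf_eq0 subr_eq0.
by rewrite (negPf z1) => /eqP.
Qed.

Definition gauss_sum : E := \sum_(x : F) psi (x ^+ 2).

(** Since y has 1 + eta(y) square roots and the part from 1 sums to zero, the sum is that of psi(c
    y) eta(y); then y is rescaled by [c]. *)
Lemma gauss_sum_scale c : c != 0 -> \sum_(x : F) psi (c * x ^+ 2) = eta c * gauss_sum.
Proof.
have gaussE a : a != 0 ->
    \sum_(x : F) psi (a * x ^+ 2) = \sum_y psi (a * y) * eta y.
  move=> a0; rewrite (partition_big (fun x => x ^+ 2) predT) //=.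
  transitivity (\sum_y (psi (a * y) + psi (a * y) * eta y)).
    apply: eq_bigr => y _; rewrite (eq_bigr (fun=> psi (a * y))); last first.
      by move=> x /eqP->.
    rewrite sumr_const -[_ *+ _]mulr_natr -[X in _ * X]/((Posz _)%:~R).
    by rewrite (card_sqrt two_neq0) rmorphD /= mulrDr mulr1.
  by rewrite big_split /= sum_psi (negPf a0) add0r.
move=> c0; rewrite gaussE // /gauss_sum.
under [in RHS]eq_bigr => x _ do rewrite -[x ^+ 2]mul1r.
rewrite gaussE ?oner_neq0 // mulr_sumr [RHS](reindex ( *%R c)) /=; last first.
  by exists ( *%R c^-1) => x _; rewrite ?mulKf ?mulVKf.
apply: eq_bigr => y _; rewrite mul1r quad_charM // rmorphM /=.
rewrite mulrCA (mulrA (eta c)) -rmorphM /= -expr2.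
by case: (quad_char_cases c0) => ->; rewrite ?sqrrN expr1n mul1r.
Qed.

(** The sum is multiplied by its twist by -1. With x = y + u, x^2 - y^2 = u^2 + 2 u y, and summing
    over y kills every u except 0. *)
Lemma gauss_sum_sqr : gauss_sum ^+ 2 = eta (-1 : F) * #|F|%:R.
Proof.
have eta2 : eta (-1 : F) * eta (-1 : F) = 1.
  rewrite -rmorphM /= -expr2.
  have : -1 != 0 :> F by rewrite oppr_eq0 oner_neq0.
  by move/quad_char_cases => [] ->; rewrite ?sqrrN expr1n.
suff <- : gauss_sum * (eta (-1 : F) * gauss_sum) = #|F|%:R.
  by rewrite [gauss_sum * _]mulrCA !mulrA eta2 mul1r expr2.
rewrite -gauss_sum_scale ?oppr_eq0 ?oner_neq0 // /gauss_sum big_distrlr /=.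
rewrite exchange_big /=.
transitivity (\sum_(u : F) psi (u ^+ 2) * \sum_(y : F) psi ((2%:R * u) * y)).
  transitivity (\sum_(y : F) \sum_(u : F) psi (u ^+ 2) * psi (2%:R * u * y)).
    apply: eq_bigr => y _; rewrite (reindex (+%R y)) /=; last first.
      by exists (+%R (- y)) => x _; rewrite ?addKr ?addNKr.
    apply: eq_bigr => u _; rewrite -!psiD; congr psi.
    by ring.
  by rewrite exchange_big /=; apply: eq_bigr => u _; rewrite mulr_sumr.
rewrite (bigD1 0) //= [X in _ + X]big1 ?addr0; last first.
  by move=> u u0; rewrite sum_psi mulf_eq0 (negPf two_neq0) (negPf u0) mulr0.
by rewrite sum_psi mulr0 eqxx expr0n psi0 mul1r.
Qed.

(** The Frobenius of [E] is additive and turns psi(x^2) into psi(q x^2). *)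
Lemma gauss_sum_frobenius q : q \in [pchar E] -> (q%:R : F) != 0 ->
  gauss_sum ^+ q = eta (q%:R : F) * gauss_sum.
Proof.
move=> qE q0; rewrite -(pFrobenius_autE qE) rmorph_sum /= -gauss_sum_scale //.
by apply: eq_bigr => x _; rewrite pFrobenius_autE -psiMn mulr_natl.
Qed.

Lemma gauss_sum_frobeniusX q s : q \in [pchar E] -> (q%:R : F) != 0 -> odd q ->
  gauss_sum ^+ (q ^ s) = eta (q%:R : F) ^+ s * gauss_sum.
Proof.
move=> qE q0 q_odd; elim: s => [|s IHs]; first by rewrite mul1r.
rewrite expnSr exprM IHs exprMn gauss_sum_frobenius // mulrA.
congr (_ * _); rewrite -exprM mulnC exprM exprSr; congr (_ ^+ _ * _).
by case: (quad_char_cases q0) => ->; rewrite ?expr1n // rmorphN rmorph1 -signr_odd q_odd.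
Qed.

(** In diagonal coordinates the sum factors: each of the first [r] coordinates gives a scaled Gauss
    sum, each other one [#|F|]. Only coordinate number [r] contributes [eta d], which therefore
    disappears when [r] is 0. *)
Lemma sum_psi_normal_form N (Q : 'rV[F]_N -> F) r d c :
    is_normal_form Q r d -> c != 0 ->
  \sum_u psi (c * Q u) = #|F|%:R ^+ (N - r) * (if r == 0%N then 1 else eta d)
                           * (eta c * gauss_sum) ^+ r.
Proof.
case/and3P=> rN d0 /existsP[M /andP[M_unit /forallP QM]] c0.
rewrite (reindex (fun u => u *m M)) /=; last first.
  by exists (fun u => u *m invmx M) => u _; rewrite ?mulmxK ?mulmxKV.
pose co (i : nat) := if (i < r)%N then c * (if i.+1 == r then d else 1) else 0.
transitivity (\sum_(u : 'rV[F]_N) \prod_(i < N) psi (co i * u 0 i ^+ 2)).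
  apply: eq_bigr => u _; rewrite (eqP (QM u)) /diag_form big_mkcond mulr_sumr psi_sum.
  apply: eq_bigr => i _; rewrite /co; case: ifP => _; last by rewrite mulr0 mul0r.
  by rewrite mulrA.
rewrite (reindex (fun f : {ffun 'I_N -> F} => \row_i f i)) /=; last first.
  exists (fun u => [ffun i => u 0 i]) => [f|u] _.
    by apply/ffunP=> i; rewrite ffunE mxE.
  by apply/rowP=> i; rewrite mxE ffunE.
under eq_bigr => f _ do under eq_bigr => i _ do rewrite mxE.
rewrite -(bigA_distr_bigA (fun (i : 'I_N) x => psi (co i * x ^+ 2))) /=.
transitivity (\prod_(i < N) ((if (i < r)%N then eta c * gauss_sum else #|F|%:R)
                              * (if i.+1 == r then eta d else 1))).
  apply: eq_bigr => i _; rewrite /co; case: ltnP => ir.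
    case: eqP => _; last by rewrite !mulr1 gauss_sum_scale.
    rewrite gauss_sum_scale ?mulf_neq0 // quad_charM // rmorphM /=.
    by rewrite mulrAC.
  under eq_bigr => x _ do rewrite mul0r psi0.
  rewrite sumr_const; case: eqP => [ri|_]; last by rewrite mulr1.
  by rewrite -ri ltnn in ir.
rewrite big_split /= mulrAC; congr (_ * _); last first.
  case: r {co QM} rN => [|r] rN; first by rewrite big1.
  rewrite (bigD1 (Ordinal rN)) //= eqxx big1 ?mulr1 // => i.
  by rewrite -val_eqE /= eqSS => /negPf->.
rewrite -(big_mkord predT (fun i => if (i < r)%N then eta c * gauss_sum else #|F|%:R)).
rewrite (big_cat_nat (leq0n r) rN) //= mulrC; congr (_ * _).
  rewrite (eq_big_nat _ _ (F2 := fun=> #|F|%:R)) ?prodr_const_nat // => i /andP[ri _].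
  by rewrite ltnNge ri.
rewrite (eq_big_nat _ _ (F2 := fun=> eta c * gauss_sum)) ?prodr_const_nat ?subn0 // => i.
by case/andP=> _ ->.
Qed.

End GaussSums.

(** * Character sums of trace forms *)

Section RankAndType.
Variables (F : finFieldType) (two_neq0 : 2%:R != 0 :> F) (N : nat).
Variables (Q : 'rV[F]_N -> F) (A : 'M[F]_N) (QA : Q =1 mx_form A).

(** A form given by a matrix has a normal form, so the search in [normal_form] succeeds and its
    default is not reached. *)
Lemma normal_formP : is_normal_form Q (quad_rank Q) (normal_form Q).2.
Proof.
rewrite /quad_rank /normal_form; case: pickP => [[r d] //=|no_nf].
have [r [d nf]] := mx_form_normal two_neq0 QA.
have rN : (r < N.+1)%N by case/and3P: nf.
by have := no_nf (Ordinal rN, d); rewrite /= nf.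
Qed.

(** This matches the convention for the type of the zero form with the case [r == 0] of
    [sum_psi_normal_form]. At the last of the diagonal coordinates a form of positive rank takes the
    value [d]. *)
Lemma quad_rank_eq0 : (quad_rank Q == 0%N) = [forall x, Q x == 0].
Proof.
have /and3P[rN d0 /existsP[M /andP[M_unit /forallP QM]]] := normal_formP.
apply/eqP/forallP => [r0 x | Q0].
  by rewrite -[x](mulmxKV M_unit) (eqP (QM _)) r0 /diag_form big_pred0.
case: (quad_rank Q) rN QM => [//|r] rN QM.
have := QM (delta_mx 0 (Ordinal rN)); rewrite (eqP (Q0 _)) /diag_form.
rewrite (bigD1 (Ordinal rN)) /= ?ltnSn // eqxx mxE !eqxx expr1n mulr1.
rewrite big1 ?addr0 => [|i /andP[_ ir]]; last by rewrite mxE eqxx (negPf ir) expr0n mulr0.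
by rewrite eq_sym (negPf d0).
Qed.

Lemma quad_nullity_le : (quad_nullity Q <= N)%N.
Proof. exact: leq_subr. Qed.

Lemma quad_type_cases : quad_type Q = 1 \/ quad_type Q = -1.
Proof.
rewrite /quad_type; case: ifP => _; first by left.
by apply: quad_char_cases; case/and3P: normal_formP.
Qed.

Lemma sum_psi_quad (E : fieldType) (psi : F -> E) :
    psi 0 = 1 -> (forall x y, psi (x + y) = psi x * psi y) ->
    (exists z, psi z != 1) -> forall c, c != 0 ->
  \sum_u psi (c * Q u) =
    #|F|%:R ^+ quad_nullity Q * (quad_type Q)%:~R
      * ((quad_char c)%:~R * gauss_sum psi) ^+ (N - quad_nullity Q).
Proof.
move=> psi0 psiD psi1 c c0.
rewrite (sum_psi_normal_form two_neq0 psi0 psiD psi1 normal_formP c0).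
have rN : (quad_rank Q <= N)%N by case/and3P: normal_formP.
rewrite /quad_nullity subKn // /quad_type -quad_rank_eq0.
by case: eqP.
Qed.

End RankAndType.

(** Each fibre of [h] is stable under the q-group generated by [sigma], so its size and its number
    of fixed points agree modulo q, the characteristic of [E]. *)
Lemma sum_fixed_points (T : finType) (E : finFieldType) (q s : nat)
    (sigma : T -> T) (h : T -> E) :
    q \in [pchar E] -> injective sigma -> iter (q ^ s) sigma =1 id ->
    (forall x, h (sigma x) = h x) ->
  \sum_x h x = \sum_(x | sigma x == x) h x.
Proof.
move=> qE inj_sigma sigma_qs h_sigma; pose g := perm inj_sigma.
have q_pr := pcharf_prime qE.
have qG : (q.-group <[g]>)%g.
  rewrite /pgroup; apply: (@pnat_dvd _ (q ^ s)); last by rewrite pnatX pnat_id.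
  rewrite -[X in (X %| _)%N]/(#[g]%g) order_dvdn; apply/eqP/permP=> x.
  rewrite perm1 permX -[RHS]sigma_qs.
  by apply: eq_iter => y; rewrite permE.
have fibre e : #|[set x | h x == e]| = #|[set x | (h x == e) && (sigma x == x)]| %[mod q].
  have act_fibre : [acts <[g]>, on [set x | h x == e] | 'P]%g.
    rewrite cycle_subG inE in_setT; apply/andP; split=> //.
    by rewrite inE; apply/subsetP=> x; rewrite !inE /= apermE permE h_sigma.
  rewrite (pgroup_fix_mod qG act_fibre) afix_cycle; congr (#|pred_of_set _| %% _)%N.
  by apply/setP=> x; rewrite !inE /= sub1set inE apermE permE.
have eq_mod (m n : nat) (e : E) : m = n %[mod q] -> e *+ m = e *+ n.
  move=> mn; rewrite -mulr_natr -[RHS]mulr_natr (divn_eq m q) (divn_eq n q) mn.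
  by rewrite !natrD !natrM (pcharf0 qE) !mulr0.
rewrite (partition_big h predT) // [RHS](partition_big h predT) //=.
apply: eq_bigr => e _.
rewrite (eq_bigr (fun=> e)) => [|x /eqP //].
rewrite [RHS](eq_bigr (fun=> e)) => [|x /andP[_ /eqP] //].
rewrite !sumr_const; have := eq_mod _ _ e (fibre e); rewrite !cardsE => ->.
by congr (_ *+ _); apply: eq_card => x; rewrite !unfold_in andbC.
Qed.

(** * The absolute trace and its quadratic forms in coordinates *)

Section TraceForm.
Variables (p : nat) (p_pr : prime p).

Section OneField.
Variable L : fieldExtType 'F_p.

Lemma pchar_ext : p \in [pchar L].
Proof. by rewrite pchar_lalg pchar_Fp. Qed.

Lemma exprDn_ext i : {morph (fun x : L => x ^+ (p ^ i)) : x y / x + y}.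
Proof.
move=> x y; apply: exprDn_pchar; rewrite pnatX.
apply/orP; left; apply/(pnatP _ (prime_gt0 p_pr)) => r r_pr.
by rewrite dvdn_prime2 // => /eqP->; exact: pchar_ext.
Qed.

Lemma expr_ext_sum i (I : finType) (h : I -> L) :
  (\sum_j h j) ^+ (p ^ i) = \sum_j h j ^+ (p ^ i).
Proof.
apply: (big_morph (fun x : L => x ^+ (p ^ i)) (@exprDn_ext i)).
by rewrite expr0n expn_eq0 eqn0Ngt prime_gt0.
Qed.

Lemma expr_Fp i (c : 'F_p) : c ^+ (p ^ i) = c.
Proof.
elim: i => [|i IHi] //; rewrite expnSr exprM IHi.
by rewrite -[in X in c ^+ X](card_Fp p_pr) expf_card.
Qed.

Lemma expr_ext_scale i (c : 'F_p) (x : L) : (c *: x) ^+ (p ^ i) = c *: x ^+ (p ^ i).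
Proof. by rewrite exprZn expr_Fp. Qed.

Lemma expr_ext_dim i (x : L) : x ^+ (p ^ (\dim {:L} * i)) = x.
Proof.
elim: i => [|i IHi]; first by rewrite muln0.
rewrite mulnS expnD exprM -[X in _ ^+ X]/(p ^ _)%N.
have := Fermat's_little_theorem {:L}%AS x.
by rewrite memvf card_Fp // => /esym/eqP ->.
Qed.

Lemma abs_trace_linear (c : 'F_p) (x y : L) :
  abs_trace (c *: x + y) = c * abs_trace x + abs_trace y.
Proof.
apply: (fmorph_inj (in_alg L)); rewrite /= scalerDl -scalerA !abs_traceE //.
rewrite scaler_sumr -big_split; apply: eq_bigr => i _ /=.
by rewrite exprDn_ext expr_ext_scale.
Qed.

Lemma abs_trace_scale (c : 'F_p) (x : L) : abs_trace (c *: x) = c * abs_trace x.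
Proof.
have tr0 : abs_trace (0 : L) = 0.
  have := abs_trace_linear 1 0 0; rewrite scaler0 addr0 mul1r => /eqP.
  by rewrite addrC -subr_eq subrr eq_sym => /eqP.
by have := abs_trace_linear c x 0; rewrite tr0 !addr0.
Qed.

Lemma abs_traceD (x y : L) : abs_trace (x + y) = abs_trace x + abs_trace y.
Proof. by have := abs_trace_linear 1 x y; rewrite scale1r mul1r. Qed.

Lemma abs_trace_sum (I : finType) (h : I -> L) :
  abs_trace (\sum_i h i) = \sum_i abs_trace (h i).
Proof.
apply: (big_morph _ abs_traceD).
by have := abs_trace_scale 0 0; rewrite scale0r mul0r.
Qed.

(** The power map passes through the sum of conjugates, which lies in the prime field and is
    fixed. *)
Lemma abs_trace_frobenius i (x : L) : abs_trace (x ^+ (p ^ i)) = abs_trace x.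
Proof.
apply: (fmorph_inj (in_alg L)); rewrite /= !abs_traceE //.
under eq_bigr => j _ do rewrite -exprM mulnC exprM.
by rewrite -expr_ext_sum -abs_traceE // -[_%:A ^+ _]/((in_alg L _) ^+ _) -rmorphXn expr_Fp.
Qed.

Definition of_coord (u : 'rV['F_p]_(\dim {:L})) : L :=
  \sum_i u 0 i *: (vbasis {:L})`_i.

Lemma of_coord_bij : bijective of_coord.
Proof.
have freeL := basis_free (vbasisP {:L}).
exists (fun x => \row_i coord (vbasis {:L}) i x) => [u | x].
  by apply/rowP=> i; rewrite mxE coord_sum_free.
rewrite /of_coord [RHS](coord_vbasis (memvf x)).
by apply: eq_bigr => i _; rewrite mxE.
Qed.

(** Power maps by p^alpha are linear over the prime field, so each monomial is a bilinear expression
    with both arguments equal; expanding in the basis gives the matrix. *)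
Lemma trace_form_mx_form k (a : 'I_k -> L) (alpha : 'I_k -> nat) :
  exists A, trace_form (\sum_(i < k) a i *: 'X^(p ^ alpha i + 1)) =1 mx_form A.
Proof.
pose b i := (vbasis {:L})`_i.
exists (\matrix_(i, j) abs_trace (\sum_l a l * b i ^+ (p ^ alpha l) * b j)) => u.
rewrite /trace_form -/(of_coord u).
have -> : (\sum_(i < k) a i *: 'X^(p ^ alpha i + 1)).[of_coord u] =
    \sum_j u 0 j *: \sum_i u 0 i *: \sum_l a l * b i ^+ (p ^ alpha l) * b j.
  rewrite horner_sum.
  transitivity (\sum_l \sum_j \sum_i u 0 j *: (u 0 i *: (a l * b i ^+ (p ^ alpha l) * b j))).
    apply: eq_bigr => l _; rewrite hornerZ hornerXn addn1 exprSr.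
    have -> : of_coord u ^+ (p ^ alpha l) = \sum_i u 0 i *: b i ^+ (p ^ alpha l).
      by rewrite /of_coord expr_ext_sum; apply: eq_bigr => i _; rewrite expr_ext_scale.
    rewrite mulrA mulr_sumr; apply: eq_bigr => j _.
    rewrite -scalerAr mulr_sumr mulr_suml scaler_sumr; apply: eq_bigr => i _.
    by rewrite -scalerAr -scalerAl.
  rewrite exchange_big; apply: eq_bigr => j _ /=; rewrite exchange_big scaler_sumr.
  by apply: eq_bigr => i _; rewrite !scaler_sumr.
rewrite abs_trace_sum /mx_form mxE; apply: eq_bigr => j _.
rewrite abs_trace_scale abs_trace_sum [in RHS]mxE mulrC; congr (_ * _); last by rewrite mxE.
by apply: eq_bigr => i _; rewrite abs_trace_scale mxE.
Qed.

Lemma sum_trace_form (E : fieldType) (h : 'F_p -> E) (f : {poly L}) :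
  \sum_u h (trace_form f u) = \sum_(x : finvect_type L) h (abs_trace f.[x]).
Proof.
rewrite [RHS](reindex (of_coord : _ -> finvect_type L)) //.
by apply: onW_bij; exact: of_coord_bij.
Qed.

End OneField.

(** * Passing from the field [K] to its extension [L] *)

Section Extension.
Variables (K L : fieldExtType 'F_p) (iota : {rmorphism K -> L}).
Variables (m n : nat) (dimK : \dim {:K} = n) (dimL : \dim {:L} = (m * n)%N).

Lemma rmorph_in_alg (c : 'F_p) : iota c%:A = c%:A.
Proof. by rewrite -[c]natr_Zp !scaler_nat rmorph_nat. Qed.

(** The [m * n] conjugates split into [m] equal runs of length [n], because [y ^+ (p ^ n)] is
    [y]. *)
Lemma abs_trace_rmorph (y : K) : abs_trace (iota y) = m%:R * abs_trace y.
Proof.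
apply: (fmorph_inj (in_alg L)); rewrite /= abs_traceE // dimL.
rewrite mulr_natl -scalerMnl -rmorph_in_alg abs_traceE // -rmorphMn /= dimK.
transitivity (iota (\sum_(i < m * n) y ^+ (p ^ i))).
  by rewrite rmorph_sum; apply: eq_bigr => i _; rewrite rmorphXn.
congr (iota _); elim: m => [|j IHj]; first by rewrite mul0n big_ord0.
rewrite mulSn addnC big_split_ord /= IHj mulrSr; congr (_ + _).
have y_jn : y ^+ (p ^ (j * n)) = y by rewrite mulnC -dimK expr_ext_dim.
by apply: eq_bigr => i _; rewrite /= expnD exprM y_jn.
Qed.

(** Over [K], X^(p^n) - X is the product of all X - y; mapped to [L], its roots are the images of
    the y. *)
Lemma fixed_field_image (x : L) :
  reflect (exists y : K, x = iota y) (x ^+ (p ^ n) == x).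
Proof.
apply: (iffP eqP) => [xpn | [y ->]]; last first.
  by rewrite -rmorphXn -(muln1 n) -dimK expr_ext_dim.
have cardK : #|finvect_type K| = (p ^ n)%N.
  have /bij_eq_card<- : bijective (@of_coord K : _ -> finvect_type K) := of_coord_bij K.
  by rewrite card_mx card_Fp // mul1n dimK.
have := congr1 (fun g => (map_poly iota g).[x]) (finField_genPoly (finvect_type K)).
rewrite cardK /= rmorphB /= map_polyXn map_polyX !hornerE xpn subrr.
rewrite rmorph_prod horner_prod => /esym/eqP; rewrite prodf_seq_eq0 => /hasP[y _] /=.
by rewrite map_polyXsubC hornerXsubC subr_eq0 => /eqP ->; exists y.
Qed.

(** The coefficients come from [K] and are fixed by this power, so f(x^(p^n)) = f(x)^(p^n), which
    has the same trace as f(x). *)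
Lemma abs_trace_map_poly_frobenius (f : {poly K}) (x : L) :
  abs_trace (map_poly iota f).[x ^+ (p ^ n)] = abs_trace (map_poly iota f).[x].
Proof.
rewrite -[in RHS](abs_trace_frobenius n); congr abs_trace.
rewrite !horner_coef expr_ext_sum; apply: eq_bigr => i _.
rewrite exprMn -!exprM mulnC; congr (_ * _); rewrite coef_map /=.
by apply/esym/eqP/fixed_field_image; exists f`_i.
Qed.

Lemma sum_trace_form_ext (E : finFieldType) (q s : nat) (h : 'F_p -> E) (f : {poly K}) :
    m = (q ^ s)%N -> q \in [pchar E] ->
  \sum_u h (trace_form (map_poly iota f) u) = \sum_u h (m%:R * trace_form f u).
Proof.
move=> m_qs qE; rewrite sum_trace_form.
rewrite (sum_trace_form (fun c => h (m%:R * c))).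
pose sigma (x : finvect_type L) : finvect_type L := x ^+ (p ^ n).
have iter_sigma i x : iter i sigma x = x ^+ (p ^ (n * i)).
  elim: i => [|i IHi]; first by rewrite muln0.
  by rewrite iterS IHi /sigma -exprM -expnD mulnS addnC.
have sigma_m : iter (q ^ s) sigma =1 id.
  by move=> x; rewrite iter_sigma -m_qs mulnC -dimL -[X in (p ^ X)%N]muln1 expr_ext_dim.
(* The iterate one short of [q ^ s] is a left inverse. *)
have inj_sigma : injective sigma.
  apply: (@can_inj _ _ _ (iter (q ^ s).-1 sigma)) => x; rewrite -iterSr prednK.
    exact: sigma_m.
  by rewrite expn_gt0 prime_gt0 // (pcharf_prime qE).
rewrite (sum_fixed_points qE inj_sigma sigma_m) => [|x]; last first.
  by rewrite abs_trace_map_poly_frobenius.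
pose iotaf (y : finvect_type K) : finvect_type L := iota y.
rewrite (eq_bigl (mem (iotaf @: setT))) => [|x]; last first.
  apply/fixed_field_image/imsetP => [[y ->]|[y _ ->]]; exists y => //.
rewrite big_imset /= => [|y z _ _]; last exact: fmorph_inj.
apply: eq_big => [y|y _]; first by rewrite inE.
by rewrite horner_map /= abs_trace_rmorph.
Qed.

End Extension.
End TraceForm.

(** * Comparison of the types *)

Lemma natr_pchar_eq1 (R : nzRingType) q i : q \in [pchar R] -> (0 < i)%N ->
  (i%:R == 1 :> R) = (q %| i.-1)%N.
Proof.
move=> qR i_gt0; rewrite (dvdn_pcharf qR) -[in LHS](prednK i_gt0).
by rewrite mulrS -subr_eq0 addrAC subrr add0r.
Qed.

(** [ord_mod] lives in the units of ['F_q], the argument in [E]; in both, a^i = 1 means that q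
    divides a^i - 1. *)
Lemma ord_mod_dvdn (E : finFieldType) q a i : prime q -> q \in [pchar E] ->
    (0 < a)%N -> ~~ (q %| a)%N ->
  (ord_mod q a %| i)%N = ((a%:R : E) ^+ i == 1).
Proof.
move=> q_pr qE a_gt0 q_a; rewrite /ord_mod order_dvdn -val_eqE /=.
(* As q does not divide [a], [insubd] returns the class of [a] and not its default. *)
rewrite FinRing.val_unitX insubdK; last first.
  by rewrite -topredE /= unitfE -(dvdn_pcharf (pchar_Fp q_pr)).
have ai_gt0 : (0 < a ^ i)%N by rewrite expn_gt0 a_gt0.
by rewrite -!natrX (natr_pchar_eq1 (pchar_Fp q_pr)) // (natr_pchar_eq1 qE).
Qed.

(** Here [x] has order [o] and 2e = k o. For odd [o], [k] is even and [o] divides [e], so both sides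
    are 1. For even [o], [x ^+ o./2] is -1 and e = (o/2) k. *)
Lemma half_power_sign (E : fieldType) (x : E) (o : nat) (e : int) :
    x != 0 -> (0 < o)%N -> (forall i, (o %| i)%N = (x ^+ i == 1)) ->
    x ^ (2 * e) = 1 ->
  x ^ e = (-1) ^ ((2 * e) %/ o)%Z.
Proof.
move=> x0 o_gt0 oP xe1.
have /dvdzP[k ek] : (o %| 2 * e)%Z.
  rewrite dvdzE absz_nat oP; case: (2 * e) xe1 => m.
    by move=> <-.
  by rewrite NegzE -exprnN => /(congr1 GRing.inv); rewrite invrK invr1 => /eqP.
rewrite ek mulzK; last by lia.
have xo : x ^ o = 1 by apply/eqP; rewrite -oP.
have [o_odd | o_even] := boolP (odd o).
  (* The cofactor is half of [k]: with o = 2h + 1, the relation 2e = k o reads k = 2 (e - k h). *)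
  have -> : e = o%:Z * (e - k * (o./2)%:Z).
    have := odd_double_half o; rewrite o_odd; nia.
  have -> : k = 2 * (e - k * (o./2)%:Z).
    have := odd_double_half o; rewrite o_odd; nia.
  by rewrite -!exprz_exp xo -[(-1) ^ 2]/((-1) ^+ 2) sqrrN expr1n !exp1rz.
have o2 : (o = o./2 * 2)%N by rewrite muln2 even_halfK.
have -> : e = (o./2)%:Z * k by lia.
rewrite -exprz_exp -[x ^ (o./2)]/(x ^+ o./2).
have [|xh1 | -> //] := @sqrr_eq1 _ (x ^+ o./2).
  by rewrite -exprM -o2; apply/eqP; rewrite -oP.
move/eqP: xh1; rewrite -oP => /dvdn_leq; lia.
Qed.

Lemma int_sub_even (m n : nat) : odd m = odd n ->
  exists e : int, m%:Z - n%:Z = 2 * e.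
Proof.
move=> mn; exists (m./2%:Z - n./2%:Z).
by have := odd_double_half m; have := odd_double_half n; rewrite mn; lia.
Qed.

Lemma intr_signz (E : fieldType) (z : int) : ((-1) ^ z)%:~R = (-1) ^ z :> E.
Proof. by rewrite rmorphXz ?unitrN1 // rmorphN1. Qed.

Lemma sign_intr_inj (E : fieldType) (i j : int) : 2%:R != 0 :> E ->
  i = 1 \/ i = -1 -> j = 1 \/ j = -1 -> i%:~R = j%:~R :> E -> i = j.
Proof.
rewrite -[2%:R]/(1 + 1) => E2; have E1N : 1 != -1 :> E by rewrite -subr_eq0 opprK.
move=> [] -> [] -> //=; rewrite rmorphN1 rmorph1 => /eqP.
  by rewrite (negPf E1N).
by rewrite eq_sym (negPf E1N).
Qed.

(** By Fermat p divides q^(p-1) - 1, so the field with q^(p-1) elements contains a primitive p-th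
    root of unity, whose powers give the character. *)
Lemma exists_additive_character p q : prime p -> prime q -> q != p ->
  exists (E : finFieldType) (psi : 'F_p -> E),
    [/\ q \in [pchar E], psi 0 = 1, forall x y, psi (x + y) = psi x * psi y
      & exists z, psi z != 1].
Proof.
move=> p_pr q_pr qp; have p1_gt0 : (0 < p.-1)%N by rewrite -ltnS prednK ?prime_gt0 ?prime_gt1.
have [E qE cardE] := pPrimePowerField q_pr p1_gt0.
have p_dvd : (p %| #|E|.-1)%N.
  rewrite cardE -(natr_pchar_eq1 (pchar_Fp p_pr)) ?expn_gt0 ?prime_gt0 // natrX.
  have q0 : (q%:R : 'F_p) != 0.
    by rewrite -(dvdn_pcharf (pchar_Fp p_pr)) dvdn_prime2 // eq_sym.
  apply/eqP/(mulfI q0); rewrite -exprS prednK ?prime_gt0 // mulr1.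
  by rewrite -[X in _ ^+ X](card_Fp p_pr) expf_card.
have [w w_prim] := finField_primitive_root E.
have zeta_prim := dvdn_prim_root w_prim p_dvd; set zeta := w ^+ _ in zeta_prim.
exists E, (fun c : 'F_p => zeta ^+ c); split=> //.
- move=> x y; have -> : x + y = ((x : nat) + (y : nat))%:R by rewrite natrD !natr_Zp.
  by rewrite val_Fp_nat // prim_expr_mod // exprD.
exists 1; rewrite -(prim_order_dvd zeta_prim) /= Fp_cast // modn_small ?prime_gt1 //.
by rewrite dvdn1 neq_ltn prime_gt1 ?orbT.
Qed.

(** * Solving for the type, with [P], [eps], [chi] for p, eta(-1), eta(q) in [E] *)

Section SignComparison.
Variables (E : fieldType) (P g t t' eps chi : E) (q s n N l l' : nat).
Hypotheses (P_neq0 : P != 0) (g_sqr : g ^+ 2 = eps * P) (eps_sqr : eps ^+ 2 = 1).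
Hypotheses (chi_sqr : chi ^+ 2 = 1) (g_frob : g ^+ (q ^ s) = chi ^+ s * g).
Hypotheses (N_n : N = (q ^ s * n)%N) (le_l : (l <= n)%N) (le_l' : (l' <= N)%N).
Hypothesis sums_eq :
  P ^+ l' * t' * g ^+ (N - l') = P ^+ l * t * (chi ^+ s * g) ^+ (n - l).

Lemma sign_neq0 (x : E) : x ^+ 2 = 1 -> x != 0.
Proof. by apply: contra_eq_neq => ->; rewrite expr0n eq_sym oner_neq0. Qed.

Lemma gauss_neq0 : g != 0.
Proof.
have := mulf_neq0 (sign_neq0 eps_sqr) P_neq0.
by rewrite -g_sqr sqrf_eq0.
Qed.

(** Multiplying [sums_eq] by g^(l' + l) removes the truncated subtractions; then g^N = chi^(s n) g^n
    allows g^n to be cancelled. *)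
Lemma types_compare_nat :
  t' * P ^+ l' * g ^+ l = t * chi ^+ (s * l) * (P ^+ l * g ^+ l').
Proof.
have chi0 := sign_neq0 chi_sqr; have g0 := gauss_neq0.
have chi_sn : chi ^+ (s * n) * chi ^+ (s * (n - l)) = chi ^+ (s * l).
  rewrite -exprD -mulnDr.
  have -> : (n + (n - l) = (n - l) * 2 + l)%N by lia.
  by rewrite mulnDr exprD mulnA mulnC exprM chi_sqr expr1n mul1r.
have gN : g ^+ N = chi ^+ (s * n) * g ^+ n by rewrite N_n exprM g_frob exprMn -exprM.
have chi2n : chi ^+ (s * n) * chi ^+ (s * n) = 1.
  by rewrite -expr2 -exprM mulnC exprM chi_sqr expr1n.
apply: (mulfI (expf_neq0 n g0)).
transitivity (chi ^+ (s * n) * (P ^+ l' * t' * g ^+ (N - l')) * g ^+ (l' + l)).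
  rewrite exprD; transitivity (P ^+ l' * t' * g ^+ l * chi ^+ (s * n) * (g ^+ (N - l') * g ^+ l')).
    rewrite -exprD subnK // gN.
    transitivity (P ^+ l' * t' * g ^+ l * (chi ^+ (s * n) * chi ^+ (s * n)) * g ^+ n); last by ring.
    by rewrite chi2n; ring.
  by ring.
rewrite sums_eq exprMn -exprM exprD -[in RHS](subnK le_l) exprD.
rewrite -chi_sn; ring.
Qed.

(** Since l' - l = 2e, g^l' is g^l (eps P)^e and P^l' is P^l P^(2e), so the Gauss sum cancels. *)
Lemma types_compare (e : int) : l'%:Z - l%:Z = 2 * e ->
  t' = t * chi ^+ (s * l) * eps ^ e * P ^ (- e).
Proof.
move=> De; have g0 := gauss_neq0.
have gz : g ^ (l'%:Z) = g ^ l * (eps * P) ^ e.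
  by rewrite -g_sqr exprnP exprz_exp -De -expfzDr // addrC subrK.
have Pz : P ^ l'%:Z = P ^ l * P ^ (2 * e) by rewrite -expfzDr // -De addrC subrK.
have := types_compare_nat; rewrite !exprnP gz Pz expfzMl.
have -> : 2 * e = e + e by lia.
rewrite expfzDr // -invr_expz.
have Pe0 : P ^ e != 0 by rewrite expfz_neq0.
have Pl0 : P ^ l != 0 by rewrite expfz_neq0.
have gl0 : g ^ l != 0 by rewrite expfz_neq0.
move=> H; apply: (mulIf gl0); apply: (mulIf Pl0); apply: (mulIf Pe0); apply: (mulIf Pe0).
transitivity (t' * (P ^ l * (P ^ e * P ^ e)) * g ^ l); first by ring.
rewrite H; field; exact: Pe0.
Qed.

End SignComparison.

Theorem theorem4p3 (p n k q s : nat) (K L : fieldExtType 'F_p)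
    (iota : {rmorphism K -> L}) (a : 'I_k.+1 -> K) (alpha : 'I_k.+1 -> nat) :
  prime p -> odd p -> (1 <= n)%N ->
  prime q -> odd q -> q != p ->
  \dim {:K} = n -> \dim {:L} = (q ^ s * n)%N ->
  (forall i j : 'I_k.+1, (i < j)%N -> (alpha i < alpha j)%N) ->
  a ord_max != 0 ->
  let f : {poly K} := \sum_(i < k.+1) a i *: 'X^(p ^ alpha i + 1) in
  let fL : {poly L} := map_poly iota f in
  let D : int := (trace_nullity fL)%:Z - (trace_nullity f)%:Z in
  trace_type fL =
    trace_type f * quad_char (q%:R : 'F_p) ^+ (s * trace_nullity f)
    * (-1) ^ ((((p - 1)%N%:Z * D) %/ 4)%Z + (D %/ (ord_mod q p)%:Z)%Z).
Proof.
move=> p_pr p_odd n_gt0 q_pr q_odd qp dimK dimL _ _ f fL D.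
have not_dvd2 r : prime r -> odd r -> ~~ (r %| 2)%N.
  by move=> r_pr r_odd; rewrite dvdn_prime2 //; apply: contraL r_odd => /eqP->.
have Fp2 : 2%:R != 0 :> 'F_p by rewrite -(dvdn_pcharf (pchar_Fp p_pr)) not_dvd2.
have [E [psi [qE psi0 psiD psi1]]] := exists_additive_character p_pr q_pr qp.
have E2 : 2%:R != 0 :> E by rewrite -(dvdn_pcharf qE) not_dvd2.
have q0 : q%:R != 0 :> 'F_p.
  by rewrite -(dvdn_pcharf (pchar_Fp p_pr)) dvdn_prime2 // eq_sym.
have q_p : ~~ (q %| p)%N by rewrite dvdn_prime2.
have P0 : p%:R != 0 :> E by rewrite -(dvdn_pcharf qE).
have [AK fAK] : exists A, trace_form f =1 mx_form A by exact: trace_form_mx_form.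
have [AL fAL] : exists A, trace_form fL =1 mx_form A.
  have -> : fL = \sum_(i < k.+1) iota (a i) *: 'X^(p ^ alpha i + 1).
    rewrite /fL rmorph_sum; apply: eq_bigr => i _ /=.
    by rewrite map_polyZ map_polyXn.
  exact: trace_form_mx_form.
have sumK := sum_psi_quad Fp2 fAK psi0 psiD psi1.
have sumL := sum_psi_quad Fp2 fAL psi0 psiD psi1.
have leK := quad_nullity_le (trace_form f); have leL := quad_nullity_le (trace_form fL).
have tK := quad_type_cases Fp2 fAK; have tL := quad_type_cases Fp2 fAL.
rewrite -!/(trace_nullity _) -!/(trace_type _) in sumK sumL leK leL tK tL.
rewrite dimK in leK; rewrite dimL in leL; rewrite card_Fp // in sumK sumL.
have chi_sign := quad_char_cases q0.
have N1_neq0 : -1 != 0 :> 'F_p by rewrite oppr_eq0 oner_neq0.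
have eps_sign := quad_char_cases N1_neq0.
have sign_sqr (i : int) : i = 1 \/ i = -1 -> (i%:~R : E) ^+ 2 = 1.
  by case=> ->; rewrite ?rmorphN1 ?rmorph1 ?sqrrN expr1n.
have g_sqr := gauss_sum_sqr Fp2 psi0 psiD psi1; rewrite card_Fp // in g_sqr.
have g_frob := gauss_sum_frobeniusX Fp2 psi0 psiD psi1 s qE q0 q_odd.
set g := gauss_sum psi in sumK sumL g_sqr g_frob.
set chi := quad_char (q%:R : 'F_p) in chi_sign g_frob *.
set l := trace_nullity f in sumK leK D *.
set l' := trace_nullity fL in sumL leL D *.
(* The upper sum at [c] is the lower sum at q^s c, whose character is eta(c) eta(q)^s. *)
have sums_eq (c : 'F_p) : c != 0 ->
    p%:R ^+ l' * (trace_type fL)%:~R * ((quad_char c)%:~R * g) ^+ (q ^ s * n - l')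
    = p%:R ^+ l * (trace_type f)%:~R
        * ((quad_char c)%:~R * (chi%:~R ^+ s * g)) ^+ (n - l).
  move=> c0; rewrite -dimL -sumL //.
  rewrite (sum_trace_form_ext p_pr iota dimK dimL (fun y => psi (c * y)) f erefl qE).
  under eq_bigr => u _ do rewrite mulrA natrX.
  rewrite sumK ?mulf_neq0 ?expf_neq0 // dimK quad_charM // quad_charX // -/chi.
  by rewrite rmorphM rmorphXn /= mulrA.
have sums_eq1 := sums_eq 1 (oner_neq0 _); rewrite quad_char1 !mul1r in sums_eq1.
have chi2 := sign_sqr _ chi_sign; have eps2 := sign_sqr _ eps_sign.
have g0 := gauss_neq0 P0 g_sqr eps2.
(* Comparing a nonsquare [c] with 1 leaves (-1)^(q^s n - l') = (-1)^(n - l), and q^s n has the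
   parity of [n]. *)
have odd_ll' : odd l' = odd l.
  have [c c0 cN] := exists_nonsquare Fp2.
  have := sums_eq c c0; rewrite cN rmorphN1 !(exprMn _ (-1)).
  rewrite mulrCA sums_eq1 [RHS]mulrCA => /mulIf.
  have X0 : p%:R ^+ l * (trace_type f)%:~R * (chi%:~R ^+ s * g) ^+ (n - l) != 0 :> E.
    have tK0 := sign_neq0 (sign_sqr _ tK); have chi0 := sign_neq0 chi2.
    by rewrite !mulf_neq0 ?expf_neq0 // mulf_neq0 ?expf_neq0.
  move=> /(_ X0); rewrite -(signr_odd _ (_ - l')) -(signr_odd _ (n - l)).
  rewrite (oddB leL) (oddB leK) oddM oddX q_odd orbT /=.
  have E1N : 1 != -1 :> E by rewrite -subr_eq0 opprK.
  by case: (odd n) (odd l') (odd l) => [] [] [] //= /eqP;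
    rewrite ?(negPf E1N) // eq_sym (negPf E1N).
have [e De] : exists e : int, D = 2 * e by exact: int_sub_even.
have cmp := types_compare P0 g_sqr eps2 chi2 g_frob erefl leK leL sums_eq1 De.
set X := p%:R ^ (- e) in cmp.
(* All other factors in [cmp] are signs, so squaring isolates [X]; this amounts to p^D = 1 in
   [E]. *)
have X2 : X ^+ 2 = 1.
  have := congr1 (fun x => x ^+ 2) cmp; rewrite !exprMn !sign_sqr // mul1r.
  rewrite -exprM mulnC exprM chi2 expr1n mul1r.
  by rewrite [in (_ ^ e) ^+ 2]exprnP exprzAC -exprnP eps2 exp1rz mul1r.
have P2e : p%:R ^ (2 * e) = 1 :> E.
  have -> : 2 * e = - e * -2 by rewrite mulrNN mulrC.
  by rewrite -exprz_exp -/X -exprnN X2 invr1.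
(* Having square 1, [X] equals its inverse p^e, to which [half_power_sign] applies. *)
have Xk : X = (-1) ^ (D %/ ord_mod q p)%Z.
  rewrite De -(half_power_sign P0 _ _ P2e) => [||i].
  - have -> : p%:R ^ e = X^-1 :> E by rewrite invr_expz opprK.
    by rewrite -[X^-1]mul1r -X2 expr2 mulfK // sign_neq0.
  - exact: order_gt0.
  by rewrite (ord_mod_dvdn _ q_pr qE) ?prime_gt0.
have epsE : quad_char (-1 : 'F_p) = (-1) ^+ p.-1./2.
  apply: (sign_intr_inj Fp2) => //.
    by rewrite -signr_odd; case: (odd _); [right | left].
  by rewrite (euler_quad_char Fp2) card_Fp // rmorphXn rmorphN1.
(* The division by 4 is exact because p - 1 and [D] are both even. *)
have exp4 : (((p - 1)%N%:Z * D) %/ 4)%Z = (p.-1./2)%:Z * e.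
  rewrite De -[RHS](@mulzK _ 4) //; congr (_ %/ _)%Z.
  have <- : (p.-1./2 * 2 = p - 1)%N.
    by rewrite muln2 subn1 even_halfK // -subn1 oddB ?prime_gt0 // p_odd.
  by rewrite PoszM; ring.
(* Both sides are signs, which [E] separates because 2 is nonzero there, so equality in [E]
   suffices. *)
apply: (sign_intr_inj E2) => //.
  apply: sqrr_eq1; rewrite !exprMn expN1r -!exprM.
  have sq1 (i : int) m : i = 1 \/ i = -1 -> i ^+ (m * 2) = 1.
    by move=> ii; rewrite mulnC exprM; case: ii => ->; rewrite ?sqrrN !expr1n.
  rewrite !sq1 //; last by right.
  by case: tK => ->; rewrite ?sqrrN expr1n.
rewrite cmp !rmorphM rmorphXn /= intr_signz expfzDr ?oppr_eq0 ?oner_neq0 //.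
rewrite -Xk mulrA; congr (_ * _ * _).
by rewrite exp4 -exprz_exp epsE rmorphXn rmorphN1.
Qed.
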